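(* Let $(k,\alpha)\in\Upsilon$. If $u\in\operatorname{rext}(L_{k,\alpha})$ and $v\in\operatorname{lext}(L_{k,\alpha})$, then there exists a word $w\in L_{k,\alpha}$ such that $uwv\in L_{k,\alpha}$.
   Context: $\Sigma_k$ is an alphabet with $k$ letters. For a nonempty finite word $r$ and a rational $\beta\ge 1$ with $\beta|r|$ an integer, the $\beta$-power $r^\beta$ is the word $rr\cdots rt$ of length $\beta|r|$, where $t$ is a prefix of $r$ (e.g. $(1234)^{7/4}=1234123$). For rational $\alpha\ge1$, a finite or infinite word is $\alpha$-power free if it has no factor that is a $\beta$-power (of some nonempty word) with $\beta\ge\alpha$, and $\alpha^+$-power free if it has no factor that is a $\beta$-power with $\beta>\alpha$. Below ''$\alpha$'' may denote either a rational number or a symbol $\alpha^+$ (''number with $+$''), and ''$\alpha$-power free'' is interpreted accordingly. $L_{k,\alpha}\subseteq\Sigma_k^*$ is the set of finite $\alpha$-power free words over $\Sigma_k$. $\Upsilon$ is the set of pairs consisting of: $(k,\alpha)$ with $k=3$ and rational $\alpha>2$; $(k,\alpha)$ with $k>3$ and rational $\alpha\ge2$; and $(k,\alpha^+)$ with $k\ge3$ and rational $\alpha\ge2$. For a language $L\subseteq\Sigma_k^*$, a word $w\in L$ is left (resp. right) extendable in $L$ if for every $n\in\mathbb N$ there is $u\in L$ with $|u|=n$ and $uw\in L$ (resp. $wu\in L$). $\operatorname{lext}(L)$ (resp. $\operatorname{rext}(L)$) is the set of left (resp. right) extendable words of $L$. *)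

(* Defs.v *)
From mathcomp Require Import all_boot all_order all_algebra.
Set Implicit Arguments. Unset Strict Implicit. Unset Printing Implicit Defensive.
Import Order.TTheory GRing.Theory Num.Theory.

Definition word (k : nat) := seq 'I_k.

(* An exponent: either a rational alpha (Plain alpha) or alpha^+ (Plus alpha). *)
Inductive exponent := Plain of rat | Plus of rat.

(* The word r r ... r t of length n (t a prefix of r), r nonempty:
   the (n/|r|)-power of r when n >= |r|. *)
Definition rpow (T : Type) (r : seq T) (n : nat) : seq T :=
  match r with
  | [::] => [::]
  | x0 :: _ => mkseq (fun i => nth x0 r (i %% size r)) n
  end.

Definition is_power_of (T : eqType) (w r : seq T) : Prop :=
  0 < size r /\ size r <= size w /\ w = rpow r (size w).

(* beta = |w|/|r| exceeds the threshold given by the exponent. *)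
Definition exceeds (e : exponent) (lw lr : nat) : bool :=
  match e with
  | Plain a => (a * lr%:R <= lw%:R)%R
  | Plus a => (a * lr%:R < lw%:R)%R
  end.

Definition is_factor (T : eqType) (f w : seq T) : Prop :=
  exists x y, w = x ++ f ++ y.

Definition power_free (k : nat) (e : exponent) (w : word k) : Prop :=
  forall f r : word k, is_factor f w -> is_power_of f r ->
    ~ exceeds e (size f) (size r).

Definition L (k : nat) (e : exponent) : word k -> Prop := power_free e.

Definition Upsilon (k : nat) (e : exponent) : Prop :=
  match e with
  | Plain a => (k = 3 /\ (2 < a)%R) \/ (3 < k /\ (2 <= a)%R)
  | Plus a => 3 <= k /\ (2 <= a)%R
  end.

Definition rext (k : nat) (Lg : word k -> Prop) (w : word k) : Prop :=
  Lg w /\ forall n : nat, exists u : word k, size u = n /\ Lg (w ++ u).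

Definition lext (k : nat) (Lg : word k -> Prop) (w : word k) : Prop :=
  Lg w /\ forall n : nat, exists u : word k, size u = n /\ Lg (u ++ w).

Arguments power_free : clear implicits.
Arguments L : clear implicits.
Arguments rext : clear implicits.
Arguments lext : clear implicits.

(* Main.v *)
(** Extend [u] to an infinite power free word [w] and let [x] be a letter recurring
    in [w].  Cutting [w] after a suitable occurrence of [x] and continuing with an
    infinite power free word [s] without [x] creates no forbidden power: as exponents
    are at least 2, such a power would force an earlier occurrence in [w] of [x]
    followed by a long prefix of [s].  Doing this twice, both [u] and the reversal of
    [v] extend to words whose tails avoid one common letter [y].  The tails are taken
    from the Thue-Morse word, or from its square free sequence of differences when
    there are three letters besides [y]; these have arbitrarily long prefixes that
    are palindromic (up to exchanging two letters), so both tails can share a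
    long [y]-free middle.  A power reaching over this middle on both sides would have
    a period longer than the middle, hence be longer than the whole word. *)

Require Import Defs.
From mathcomp Require Import all_boot all_order all_algebra.
From mathcomp Require Import zify boolp.
Set Implicit Arguments. Unset Strict Implicit. Unset Printing Implicit Defensive.
Import Order.TTheory GRing.Theory Num.Theory.

(** * Periods and forbidden powers in sequences *)

Definition periodic (T : Type) (w : nat -> T) (i n p : nat) : Prop :=
  forall j, j + p < n -> w (i + j) = w (i + j + p).

(** [ex n p] marks length [n] with period [p] as forbidden; only factors ending by [N] count. *)
Definition free (T : Type) (ex : nat -> nat -> bool) (w : nat -> T) (N : nat) : Prop :=
  forall i n p, 0 < p -> i + n <= N -> ex n p -> ~ periodic w i n p.

Definition recurrent (T : Type) (w : nat -> T) (x : T) : Prop :=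
  forall n, exists2 m, n <= m & w m = x.

(** Otherwise each [c] fails from some bound [N c] on, and all fail at the largest bound. *)
Lemma finite_pigeonhole (T : finType) (Q : T -> nat -> Prop) :
  (forall c m n, m <= n -> Q c n -> Q c m) ->
  (forall n, exists c, Q c n) -> exists c, forall n, Q c n.
Proof.
move=> Qanti Qex; apply: contrapT => /forallNP nQ.
have {}nQ c : exists n, ~ Q c n by apply/existsNP/nQ.
have [N nQN] := choice nQ.
have [c Qc] := Qex (\max_c N c).
by apply: (nQN c); apply: Qanti Qc; exact: leq_bigmax.
Qed.

(** * Cutting and joining power free sequences *)

Section Splice.

Variables (T : eqType) (ex : nat -> nat -> bool).
Hypothesis ex2 : forall n p, ex n p -> 2 * p <= n.

Lemma eq_free (w w' : nat -> T) N :
  (forall i, i < N -> w i = w' i) -> free ex w N -> free ex w' N.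
Proof.
move=> eqw fw i n p p0 le exnp per; apply: (fw i n p p0 le exnp) => j lt.
by rewrite !eqw ?per //; lia.
Qed.

Lemma free_rev (w : nat -> T) N :
  free ex w N -> free ex (fun i => w (N - i.+1)) N.
Proof.
move=> fw i n p p0 le exnp per; apply: (fw (N - (i + n)) n p p0 _ exnp).
  by lia.
move=> j lt; have /= := per (n - (j + p).+1) ltac:(lia).
have -> : N - (i + (n - (j + p).+1)).+1 = N - (i + n) + j + p by lia.
by have -> : N - (i + (n - (j + p).+1) + p).+1 = N - (i + n) + j by lia.
Qed.

Definition splice (w s : nat -> T) (P i : nat) : T :=
  if i <= P then w i else s (i - P.+1).

Definition occurs (w s : nat -> T) (x : T) (q l : nat) : Prop :=
  w q = x /\ forall j, j < l -> w (q + j.+1) = s j.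

Lemma occursW (w s : nat -> T) x q l m : m <= l -> occurs w s x q l -> occurs w s x q m.
Proof. by move=> le [wq ws]; split=> // j lt; apply: ws; lia. Qed.

(* A forbidden power straddling position [P] and ending [l] letters after it has
   period [p > l], since [x] does not occur in [s]; shifting by [p] then moves
   [x s_0 ... s_(l-1)] back inside [w]. *)
Lemma splice_free (w s : nat -> T) x P m :
  (forall N, free ex w N) -> (forall N, free ex s N) -> (forall i, s i <> x) ->
  occurs w s x P m ->
  (forall q l, m < l -> q + l < P -> P <= 2 * q + 1 + l -> ~ occurs w s x q l) ->
  forall N, free ex (splice w s P) N.
Proof.
move=> fw fs sx [wP ws] noocc N i n p p0 le exnp per.
have n2p := ex2 exnp.
have spl_ge j : splice w s P (P + j.+1) = s j.
  by rewrite /splice ifF; [congr s; lia | lia].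
have [le_in | lt_in] := leqP (i + n) (P + m.+1).
  have agree j : j < i + n -> splice w s P j = w j.
    move=> ltj; have [leP|gtP] := leqP j P; first by rewrite /splice leP.
    have -> : j = P + (j - P.+1).+1 by lia.
    by rewrite spl_ge ws //; lia.
  apply: (fw (i + n) i n p) => // j lt.
  by rewrite -!agree ?per //; lia.
have [gtP | leP] := ltnP P i.
  apply: (fs (i + n) (i - P.+1) n p) => //; first by lia.
  move=> j lt; have := per j lt.
  have -> : i + j + p = P + (i - P.+1 + j + p).+1 by lia.
  have -> : i + j = P + (i - P.+1 + j).+1 by lia.
  by rewrite !spl_ge.
have per' j : i <= j -> j + p < i + n -> splice w s P j = splice w s P (j + p).
  by move=> lej lt; have := per (j - i) ltac:(lia); rewrite subnKC.
have splP : splice w s P P = x by rewrite /splice leqnn.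
have [lep | ltp] := leqP p (i + n - P.+1).
  by apply: (sx p.-1); rewrite -spl_ge prednK // -per' //; lia.
(* Exponent at least 2 yields the bound [P <= 2 * q + 1 + l] for [q = P - p] and
   [l = i + n - P.+1]. *)
apply: (noocc (P - p) (i + n - P.+1)); try lia.
have small j : j <= P -> splice w s P j = w j by rewrite /splice => ->.
split=> [|j lt].
  rewrite -small ?leq_subr // (per' (P - p)); [|lia|lia].
  by rewrite subnK //; lia.
rewrite -small; last by lia.
rewrite (per' (P - p + j.+1)); [|lia|lia].
have -> : P - p + j.+1 + p = P + j.+1 by lia.
exact: spl_ge.
Qed.

(** If [x] followed by [N1] letters of [s] recurs in [w], its first occurrence from [N0] on is a
    good cut. Otherwise some longest prefix, of length [m], recurs after [x], and a far enough
    occurrence of it is a good cut. *)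
Lemma splice_exists (w s : nat -> T) x N0 :
  (forall N, free ex w N) -> (forall N, free ex s N) -> (forall i, s i <> x) ->
  recurrent w x ->
  exists P, [/\ N0 <= P, w P = x & forall N, free ex (splice w s P) N].
Proof.
move=> fw fs sx wx.
pose rec l := forall n, exists2 m, n <= m & occurs w s x m l.
have [N1 leN1 wN1] := wx N0.
(* An occurrence running over an [x] of [w] would put [x] into [s]. *)
have blocked q l N2 : w N2 = x -> q < N2 -> N2 <= q + l -> ~ occurs w s x q l.
  move=> wN2 lt le [_ ws]; apply: (sx (N2 - q.+1)).
  by rewrite -ws; [rewrite -wN2; congr w; lia | lia].
have [|nrecN1] := EM (rec N1).
  move=> /(_ N0) [P0 leP0 occP0].
  pose good q := `[< N0 <= q /\ occurs w s x q N1 >].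
  have exgood : exists q, good q by exists P0; apply/asboolP.
  case: (ex_minnP exgood) => P /asboolP[leP occP] minP.
  exists P; split=> //; first by case: occP.
  apply: (splice_free fw fs sx occP) => q l lt1 lt2 _ occq.
  have [geq|ltq] := leqP N0 q.
    have : P <= q by apply: minP; apply/asboolP; split=> //; apply: occursW occq; lia.
    by lia.
  by apply: (blocked q l N1 wN1) occq; lia.
have rec0 : rec 0 by move=> n; have [m le wm] := wx n; exists m.
have [m recm nrecm] : exists2 m, rec m & ~ rec m.+1.
  elim: N1 nrecN1 {leN1 wN1} => [|l IH] nrec; first by case: nrec.
  by have [recl|nrecl] := EM (rec l); [exists l | apply: IH].
have [N noN] : exists N, forall q, N <= q -> ~ occurs w s x q m.+1.
  apply: contrapT => /forallNP nN; apply: nrecm => n.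
  have /existsNP[q /not_implyP[le /contrapT occ]] := nN n.
  by exists q.
have [N2 leN2 wN2] := wx N.
(* With [q < N <= N2] and [P <= 2 * q + 1 + l], this size of [P] forces [q + l >= N2]. *)
have [P leP occP] := recm (N0 + 3 * N2 + 1).
exists P; split; [by lia | by case: occP |].
apply: (splice_free fw fs sx occP) => q l lt1 lt2 leP2 occq.
have ltq : q < N.
  by rewrite ltnNge; apply/negP => /noN; apply; apply: occursW occq.
by apply: (blocked q l N2 wN2) occq; lia.
Qed.

(** The glued word is [w1] up to [P1], then [N] letters of [s1], then [w2] read backwards from [P2]
    to 0. A power missing one of the outer blocks lies in one spliced word, possibly reversed. *)
Lemma free_glue (w1 s1 w2 s2 : nat -> T) y P1 P2 N :
  (forall i, s1 i <> y) -> w1 P1 = y ->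
  free ex (splice w1 s1 P1) (P1.+1 + N) -> free ex (splice w2 s2 P2) (P2.+1 + N) ->
  (forall i, i < N -> s1 i = s2 (N - i.+1)) -> P1 + P2 < N ->
  free ex (fun i => if i < P1.+1 + N then splice w1 s1 P1 i
                    else w2 (P1 + N + P2.+1 - i)) (P1.+1 + N + P2.+1).
Proof.
move=> s1y w1P f1 f2 s12 leN.
set Z := fun i => _.
have Zl i : i < P1.+1 + N -> Z i = splice w1 s1 P1 i by rewrite /Z => ->.
have Zr i : i < N + P2.+1 -> Z (P1.+1 + i) = splice w2 s2 P2 (P2.+1 + N - i.+1).
  move=> lt; rewrite /Z /splice ltn_add2l; case: ltnP => lti.
    rewrite ifF ?ifF; [|lia|lia].
    by rewrite [_ - _]addKn s12 //; congr s2; lia.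
  by rewrite ifT; [congr w2; lia|lia].
move=> i n p p0 le exnp per; have n2p := ex2 exnp.
have [le1|gt1] := leqP (i + n) (P1.+1 + N).
  by apply: (@eq_free _ Z _ _ f1 i n p) => // j lt; rewrite Zl.
have [gti|lei] := ltnP P1 i.
  have f2' : free ex (fun j => Z (P1.+1 + j)) (N + P2.+1).
    have := free_rev f2; rewrite [P2.+1 + N]addnC; apply: eq_free => j lt.
    by rewrite Zr // [P2.+1 + N]addnC.
  apply: (f2' (i - P1.+1) n p) => //; first by lia.
  move=> j lt; have := per j lt.
  have -> : i + j + p = P1.+1 + (i - P1.+1 + j + p) by lia.
  by have -> : i + j = P1.+1 + (i - P1.+1 + j) by lia.
(* For [p > N], [n >= 2 * p] exceeds the whole length as [P1 + P2 < N]; for [p <= N], the [y] at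
   [P1] would reappear inside [s1]. *)
have [lep|ltp] := leqP p N; last by lia.
have := per (P1 - i) ltac:(lia); rewrite subnKC // !Zl; [|lia|lia].
rewrite /splice leqnn ifF; last by lia.
by rewrite w1P => /esym /s1y.
Qed.

End Splice.

(** * The Thue-Morse word and its differences *)

Fixpoint thue_morse_rec (fuel n : nat) : bool :=
  if fuel is f.+1 then odd n (+) thue_morse_rec f n./2 else false.

(** Parity of the binary digit sum; fuel [n] suffices for the repeated halving. *)
Definition thue_morse (n : nat) : bool := thue_morse_rec n n.

Lemma thue_morseE n : thue_morse n = odd n (+) thue_morse n./2.
Proof.
have rec0 f : thue_morse_rec f 0 = false by elim: f.
have stable f g m : m <= f -> m <= g -> thue_morse_rec f m = thue_morse_rec g m.
  elim: f g m => [|f IH] [|g] [|m] //= lef leg; rewrite ?rec0 //.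
  by congr (_ (+) _); apply: IH; lia.
case: n => [|n] //; rewrite /thue_morse [in LHS]/=; congr (_ (+) _).
by apply: stable; lia.
Qed.

Lemma thue_morse_double n : thue_morse n.*2 = thue_morse n.
Proof. by rewrite thue_morseE odd_double doubleK. Qed.

Lemma thue_morse_doubleS n : thue_morse n.*2.+1 = ~~ thue_morse n.
Proof. by rewrite thue_morseE /= odd_double uphalf_double. Qed.

Lemma thue_morse_even j : ~~ odd j -> thue_morse j.+1 = ~~ thue_morse j.
Proof.
move=> ev; rewrite -(even_halfK ev).
by rewrite thue_morse_doubleS thue_morse_double.
Qed.

Lemma thue_morse_overlap_free p i :
  0 < p -> ~ (forall j, j <= p -> thue_morse (i + j) = thue_morse (i + j + p)).
Proof.
elim/ltn_ind: p i => p IH i p0 per.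
have [oddp | evp] := boolP (odd p).
  (* Both halves of the overlap see the pair starting at [j] with opposite
     parities, so consecutive letters always differ; as [p] is odd, so do the
     letters at [i] and [i + p]. *)
  have alt j : j <= p -> thue_morse (i + j) = odd j (+) thue_morse i.
    elim: j => [|j IHj] lej; first by rewrite addn0.
    have step : thue_morse (i + j.+1) = ~~ thue_morse (i + j).
      have [od|ev] := boolP (odd (i + j)); last by rewrite addnS thue_morse_even.
      rewrite (per j.+1 lej) (per j (ltnW lej)) addnS addSn thue_morse_even //.
      by rewrite oddD od oddp.
    by rewrite step IHj ?(ltnW lej) //= addNb.
  have := per 0 isT; rewrite addn0 alt // oddp.
  by case: (thue_morse i).
have pE : p = p./2.*2 by rewrite even_halfK.
(* Positions of the same parity as [i] carry an overlap of half the period. *)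
apply: (IH p./2 _ i./2); [lia | lia |] => j lej.
have := per j.*2 ltac:(lia).
have -> : i + j.*2 + p = odd i + (i./2 + j + p./2).*2 by lia.
have -> : i + j.*2 = odd i + (i./2 + j).*2 by lia.
case: (odd i); rewrite ?add0n ?add1n ?thue_morse_double // !thue_morse_doubleS.
exact: negb_inj.
Qed.

(** Passing from [i] to [2 ^ n - i.+1] flips all [n] binary digits. *)
Lemma thue_morse_mirror n i :
  i < 2 ^ n -> thue_morse (2 ^ n - i.+1) = odd n (+) thue_morse i.
Proof.
elim: n i => [|n IH] i; first by case: i.
rewrite expnS => lt.
have ih := IH i./2 ltac:(lia).
have := odd_double_half i; case od: (odd i) => /= iE.
  have -> : 2 * 2 ^ n - i.+1 = (2 ^ n - i./2.+1).*2 by lia.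
  by rewrite thue_morse_double ih -[in RHS]iE add1n thue_morse_doubleS addbN addNb negbK.
have -> : 2 * 2 ^ n - i.+1 = (2 ^ n - i./2.+1).*2.+1 by lia.
by rewrite thue_morse_doubleS ih -[in RHS]iE add0n thue_morse_double addNb.
Qed.

Lemma thue_morse_not_periodic n i p :
  0 < p -> 2 * p < n -> ~ periodic thue_morse i n p.
Proof.
move=> p0 lt per; apply: (@thue_morse_overlap_free p i p0) => j lej.
by apply: per; lia.
Qed.

(* The differences [thue_morse i.+1 - thue_morse i], written with letters
   [a], [b], [c] for [1], [-1], [0]. *)
Definition thue_morse_diff (T : Type) (a b c : T) (i : nat) : T :=
  if thue_morse i == thue_morse i.+1 then c else if thue_morse i then b else a.

(** Summing the [p] equal pairs of differences of a square yields [p + 1] equal pairs of letters, an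
    overlap of Thue-Morse. *)
Lemma thue_morse_diff_square_free (T : eqType) (a b c : T) i n p :
  uniq [:: a; b; c] -> 0 < p -> 2 * p <= n -> ~ periodic (thue_morse_diff a b c) i n p.
Proof.
rewrite /= !inE negb_or andbT => /andP[/andP[/eqP ab /eqP ac] /eqP bc] p0 n2p per.
set t := thue_morse.
have step j : j < p ->
    (t (i + j) == t (i + j).+1) = (t (i + j + p) == t (i + j + p).+1) /\
    (t (i + j) != t (i + j).+1 -> t (i + j) = t (i + j + p)).
  move=> ltj; have := per j ltac:(lia); rewrite /thue_morse_diff -/t.
  by do 4 case: (t _) => //=; move/esym => // /esym.
(* Equal differences keep [t (j + p) - t j] constant; were it nonzero, [t (i + p)]
   would have both values. *)
have cst j : j <= p -> (t (i + j) == t (i + j + p)) = (t i == t (i + p)).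
  elim: j => [|j IH] lej; first by rewrite addn0.
  rewrite -IH; last by lia.
  have [e d] := step j lej; move: e d; rewrite addnS addSn.
  by do 4 case: (t _) => //=; move=> _ d; have := d isT.
have tE : t i == t (i + p).
  apply/negPn/negP => ne.
  have nej j : j <= p -> t (i + j) = t i.
    elim: j => [|j IH] lej; first by rewrite addn0.
    have ltj : j < p by [].
    have [_ d] := step j ltj.
    have := cst j (ltnW ltj); rewrite (negPf ne) => /eqP nj.
    rewrite addnS -IH ?(ltnW ltj) //; apply/esym/eqP/negPn/negP => /d.
    exact: nj.
  by rewrite nej // eqxx in ne.
apply: (@thue_morse_overlap_free p i p0) => j lej.
by apply/eqP; rewrite cst.
Qed.

(** * Exponents in [Upsilon] and tails avoiding a letter *)

Lemma Upsilon_ge3 k e : Upsilon k e -> 2 < k.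
Proof. by case: e => a /=; [case=> [[-> _]|[/ltnW]] | case]. Qed.

Lemma exceeds_ge2 k e n p : Upsilon k e -> exceeds e n p -> 2 * p <= n.
Proof.
move=> U ex; rewrite -(ler_nat rat) natrM.
have p0 : (0 <= p%:R :> rat)%R by apply: ler0n.
case: e U ex => a /= U ex; first have a2 : (2 <= a)%R by case: U => [[_ /ltW]|[]].
  by apply: le_trans ex; apply: ler_wpM2r.
by case: U => _ a2; apply: le_trans (ltW ex); apply: ler_wpM2r.
Qed.

(** Over three letters squares are allowed, so a binary tail need only avoid overlaps. *)
Lemma exceeds_gt2 e n p : Upsilon 3 e -> 0 < p -> exceeds e n p -> 2 * p < n.
Proof.
move=> U p_gt0 ex; rewrite -(ltr_nat rat) natrM.
have p0 : (0 < p%:R :> rat)%R by rewrite ltr0n.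
case: e U ex => a /= U ex.
  by case: U => [[_ a2]|[]//]; apply: lt_le_trans ex; rewrite ltr_pM2r.
by case: U => _ a2; apply: le_lt_trans ex; rewrite ler_wpM2r // ltW.
Qed.

Lemma fresh_letter k (l : seq 'I_k) : size l < k -> exists x, x \notin l.
Proof.
move=> lt; apply: contrapT => /forallNP all_l.
have : #|'I_k| <= size l.
  apply: leq_trans (card_size l); apply/subset_leq_card/subsetP => x _.
  exact/negbNE/negP/all_l.
by rewrite card_ord leqNgt lt.
Qed.

Lemma thue_morse_recurrent n : exists2 m, n <= m & ~~ thue_morse m.
Proof.
have [tn|ntn] := boolP (thue_morse n); last first.
  by exists n.
by exists n.*2.+1; [lia | rewrite thue_morse_doubleS tn].
Qed.

Lemma tail_words k e (y y' : 'I_k) : Upsilon k e -> y' != y ->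
  exists s s' : nat -> 'I_k,
    [/\ (forall i, s i <> y) /\ (forall i, s' i <> y),
        forall N, free (exceeds e) s N, forall N, free (exceeds e) s' N,
        recurrent s y' &
        forall n, exists2 N, n < N & forall i, i < N -> s i = s' (N - i.+1)].
Proof.
move=> U neq; have k3 := Upsilon_ge3 U.
have [b] := @fresh_letter k [:: y; y'] k3.
rewrite !inE negb_or => /andP[/eqP by0 /eqP by'].
(* An even exponent makes the prefix a palindrome. *)
have mirror i n : i < 2 ^ n.*2 -> thue_morse (2 ^ n.*2 - i.+1) = thue_morse i.
  by move=> /thue_morse_mirror ->; rewrite odd_double.
have big n : n < 2 ^ n.*2 by rewrite (leq_trans (ltn_expl n (ltnSn 1))) // leq_exp2l; lia.
have [k_eq3 | k_gt3] : k = 3 \/ 3 < k by lia.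
  pose s i := if thue_morse i then b else y'.
  have sf N : free (exceeds e) s N.
    move=> i n p p0 _ ex per.
    have lt : 2 * p < n by apply: exceeds_gt2 ex => //; rewrite -k_eq3.
    apply: (@thue_morse_not_periodic n i p p0 lt) => j ltj.
    have := per j ltj; rewrite /s.
    by do 2 case: (thue_morse _) => //; move=> eq_by'; case: by'.
  exists s, s; split=> //.
  - by split=> i; rewrite /s; case: ifP => // _; apply/eqP.
  - move=> n; have [m le nt] := thue_morse_recurrent n.
    by exists m; rewrite // /s (negPf nt).
  - move=> n; exists (2 ^ n.*2) => // i lt.
    by rewrite /s mirror.
have [c] := @fresh_letter k [:: y; y'; b] k_gt3.
rewrite !inE !negb_or => /and3P[/eqP cy cy' cb].
have by'' : b != y' by apply/eqP.
have sf (a1 a2 : 'I_k) N : uniq [:: a1; a2; c] ->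
    free (exceeds e) (thue_morse_diff a1 a2 c) N.
  move=> un i n p p0 _ ex; apply: thue_morse_diff_square_free => //.
  exact: exceeds_ge2 U ex.
(* Reversal negates differences, hence the exchange of [y'] and [b]. *)
exists (thue_morse_diff y' b c), (thue_morse_diff b y' c); split.
- by split=> i; rewrite /thue_morse_diff; case: ifP => // _; case: ifP => // _; apply/eqP.
- by move=> N; apply: sf; rewrite /= !inE !negb_or !andbT ![_ == c]eq_sym cy' cb eq_sym by''.
- by move=> N; apply: sf; rewrite /= !inE !negb_or !andbT ![_ == c]eq_sym cy' cb by''.
- move=> n; have [m le nt] := thue_morse_recurrent n.
  exists m.*2; first by lia.
  by rewrite /thue_morse_diff thue_morse_doubleS thue_morse_double (negPf nt).
(* A palindrome has one difference fewer than letters; [n.+1] keeps the count above [n]. *)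
move=> n; exists (2 ^ n.+1.*2).-1; first by have := big n.+1; lia.
move=> i lt; rewrite /thue_morse_diff.
have -> : (2 ^ n.+1.*2).-1 - i.+1 = 2 ^ n.+1.*2 - i.+2 by lia.
have -> : (2 ^ n.+1.*2 - i.+2).+1 = 2 ^ n.+1.*2 - i.+1 by lia.
rewrite !mirror; try lia.
by do 2 case: (thue_morse _).
Qed.

(** * From finite words to infinite extensions *)

Lemma nth_rpow (T : Type) x0 (r : seq T) n j :
  0 < size r -> j < n -> nth x0 (rpow r n) j = nth x0 r (j %% size r).
Proof.
case: r => [//|z r] _ lt; rewrite nth_mkseq //.
by apply: set_nth_default; rewrite ltn_mod.
Qed.

Lemma size_rpow (T : Type) (r : seq T) n : 0 < size r -> size (rpow r n) = n.
Proof. by case: r => [//|z r] _; rewrite size_mkseq. Qed.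

Section PowerFree.

Variables (k : nat) (e : exponent) (x0 : 'I_k).
Hypothesis U : Upsilon k e.

Lemma power_freeP (W : word k) :
  power_free k e W <-> free (exceeds e) (nth x0 W) (size W).
Proof.
split=> [pf i n p p0 le ex per | fW f r [x [y WE]] [r0 [ler fE]] ex].
  have n2p := exceeds_ge2 U ex.
  pose f := take n (drop i W); pose r := take p f.
  have szf : size f = n by rewrite size_takel // size_drop; lia.
  have szr : size r = p by rewrite size_takel // szf; lia.
  have : exceeds e (size f) (size r) by rewrite szf szr.
  apply: pf.
    exists (take i W), (drop n (drop i W)).
    by rewrite cat_take_drop cat_take_drop.
  rewrite /is_power_of szf szr; split=> //; split; first by lia.
  apply: (@eq_from_nth _ x0); first by rewrite size_rpow ?szf ?szr.
  rewrite szf => j; elim/ltn_ind: j => j IH ltj.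
  rewrite nth_rpow ?szr //.
  have [ltp|gep] := ltnP j p; first by rewrite modn_small // [in RHS]nth_take.
  have := IH (j - p) ltac:(lia) ltac:(lia).
  rewrite nth_rpow ?szr //; last by lia.
  rewrite -[in j %% p](subnK gep) modnDr => <-.
  rewrite !nth_take; [|lia|lia].
  rewrite !nth_drop; have := per (j - p) ltac:(lia).
  by rewrite -addnA subnK.
apply: (fW (size x) (size f) (size r) r0 _ ex).
  by rewrite WE !size_cat addnA leq_addr.
move=> j lt; rewrite WE !nth_cat -addnA !ltnNge !leq_addr /= !addKn.
have ltj : j < size f := leq_ltn_trans (leq_addr _ _) lt.
rewrite !(leqNgt (size f)) lt ltj /= fE !nth_rpow // modnDr //.
Qed.

Lemma L_factor (f W : word k) : L k e W -> is_factor f W -> L k e f.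
Proof.
move=> LW [x [y WE]] g r [x' [y' fE]]; apply: LW.
by exists (x ++ x'), (y' ++ y); rewrite WE fE !catA.
Qed.

Lemma L_rev (W : word k) : L k e W -> L k e (rev W).
Proof.
move/power_freeP/free_rev => fW; apply/power_freeP; rewrite size_rev.
by apply: eq_free fW => i lt; rewrite nth_rev.
Qed.

Lemma rext_step (w : word k) : rext k (L k e) w -> exists c, rext k (L k e) (rcons w c).
Proof.
move=> [Lw ext].
have [||c Qc] := @finite_pigeonhole _
    (fun c n => exists z : word k, size z = n /\ L k e (rcons w c ++ z)).
- move=> c m n le [z [szz Lz]]; exists (take m z); split.
    by rewrite size_takel // szz.
  apply: L_factor Lz _; exists [::], (drop m z).
  by rewrite /= -catA cat_take_drop.
- move=> n; have [[|c z] [//= [szz] Lz]] := ext n.+1.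
  by exists c, z; rewrite cat_rcons.
exists c; split=> //.
by have [z [/size0nil -> ]] := Qc 0; rewrite cats0.
Qed.

Lemma rext_infinite (u : word k) : rext k (L k e) u ->
  exists w : nat -> 'I_k, (forall i, i < size u -> w i = nth x0 u i) /\
    forall N, free (exceeds e) w N.
Proof.
move=> ru.
(* Stated for every word so that [choice] gives a total [next]. *)
have step w : exists c, rext k (L k e) w -> rext k (L k e) (rcons w c).
  have [/rext_step[c rc]|nr] := EM (rext k (L k e) w); first by exists c.
  by exists x0.
have [next nextP] := choice step.
pose W n := iter n (fun w => rcons w (next w)) u.
have szW n : size (W n) = size u + n.
  by elim: n => [|n IH]; rewrite ?addn0 //= size_rcons IH addnS.
have rW n : rext k (L k e) (W n) by elim: n => [//|n IH]; apply: nextP.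
have WD n d i : i < size (W n) -> nth x0 (W (n + d)) i = nth x0 (W n) i.
  move=> lt; elim: d => [|d IH]; first by rewrite addn0.
  by rewrite addnS /= nth_rcons ifT // szW; move: lt; rewrite szW; lia.
exists (fun i => nth x0 (W i.+1) i); split=> [i lt|N].
  by rewrite -[in LHS](add0n i.+1) WD.
have [/power_freeP LW _] := rW N.
move=> i n p p0 le; rewrite szW in LW.
apply: (@eq_free _ _ (nth x0 (W N)) _ N _ _ i n p p0 le) => [j lt|].
  by rewrite -(subnKC lt) WD // szW; lia.
by move=> i' n' p' p0' le'; apply: LW => //; lia.
Qed.

(** Some letter [x] recurs; if [x] is not [y], splice in a tail that avoids [x] and has [y]
    recurring. *)
Lemma rext_recurrent (u : word k) (y : 'I_k) : rext k (L k e) u ->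
  exists w : nat -> 'I_k, [/\ forall i, i < size u -> w i = nth x0 u i,
    forall N, free (exceeds e) w N & recurrent w y].
Proof.
move=> /rext_infinite[w [wu fw]].
have [||x recx] := @finite_pigeonhole _ (fun x n => exists2 m, n <= m & w m = x).
- by move=> c m n le [q leq wq]; exists q => //; apply: leq_trans leq.
- by move=> n; exists (w n), n.
have [yx|neq] := eqVneq y x; first by exists w; split; rewrite ?yx.
have [s [_ [[sx _] fs _ recy _]]] := tail_words U neq.
have ex2 := fun n p => @exceeds_ge2 k e n p U.
have [P [leP _ fP]] := splice_exists ex2 (size u) fw fs sx recx.
exists (splice w s P); split=> // [i lt|n].
  by rewrite /splice ifT ?wu //; lia.
have [m le sm] := recy n; exists (P.+1 + m); first by lia.
by rewrite /splice ifF ?addKn //; lia.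
Qed.

End PowerFree.

(** * Joining [u] and [v] *)

Theorem mainTheorem1 (k : nat) (e : exponent) (u v : word k) :
  Upsilon k e -> rext k (L k e) u -> lext k (L k e) v ->
  exists w : word k, L k e w /\ L k e (u ++ w ++ v).
Proof.
move=> U ru [Lv extv].
have k3 := Upsilon_ge3 U.
pose y : 'I_k := Ordinal (ltnW (ltnW k3)).
have rv : rext k (L k e) (rev v).
  split=> [|n]; first exact: L_rev.
  have [z [szz Lz]] := extv n; exists (rev z); rewrite size_rev; split=> //.
  by rewrite -rev_cat; exact: L_rev.
have [y'] := @fresh_letter k [:: y] (ltnW k3); rewrite inE => neq.
have ex2 := fun n p => @exceeds_ge2 k e n p U.
have [s1 [s2 [[s1y s2y] fs1 fs2 _ s12]]] := tail_words U neq.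
have [w1 [w1u fw1 rec1]] := rext_recurrent y U y ru.
have [w2 [w2v fw2 rec2]] := rext_recurrent y U y rv.
have [P1 [leP1 w1P f1]] := splice_exists ex2 (size u) fw1 fs1 s1y rec1.
have [P2 [leP2 w2P f2]] := splice_exists ex2 (size v) fw2 fs2 s2y rec2.
have [N ltN mirror] := s12 (P1 + P2).
have := free_glue ex2 s1y w1P (f1 _) (f2 _) mirror ltN.
set Z := fun i => _; set M := _ + P2.+1 => fZ.
pose WZ := mkseq Z M.
have LZ : L k e WZ.
  apply/(power_freeP y U); rewrite size_mkseq.
  by apply: eq_free fZ => i lt; rewrite nth_mkseq.
(* As [size u <= P1] and [size v <= P2], the glued word still starts with [u] and ends with [v]. *)
pose w := take (M - size u - size v) (drop (size u) WZ).
have ZE : WZ = u ++ w ++ v.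
  rewrite -[LHS](cat_take_drop (size u)).
  rewrite -[drop (size u) WZ](cat_take_drop (M - size u - size v)).
  congr (_ ++ (_ ++ _)).
    have szu : size (take (size u) WZ) = size u.
      by rewrite size_takel // size_mkseq /M; lia.
    apply: (@eq_from_nth _ y) => // i; rewrite szu => lt.
    rewrite nth_take // nth_mkseq; last by rewrite /M; lia.
    by rewrite /Z ifT /splice ?ifT ?w1u //; lia.
  rewrite drop_drop.
  have szd : size (drop (M - size u - size v + size u) WZ) = size v.
    by rewrite size_drop size_mkseq /M; lia.
  apply: (@eq_from_nth _ y) => // i; rewrite szd => lt.
  rewrite nth_drop nth_mkseq; last by lia.
  rewrite /Z ifF; last by lia.
  rewrite w2v ?size_rev; last by lia.
  by rewrite nth_rev; [congr nth; lia | lia].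
exists w; split; last by rewrite -ZE.
by apply: L_factor LZ _; exists u, v.
Qed.
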